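(* Let $(X,S,\tau)$ be a singular pair, and let $Ab^{fh}=Ab^{fh}(X,S,\tau)$ be its universal abelian group with the maps $\pi_f,\pi_h:X\times X\to Ab^{fh}$. Then: 1. The pair of maps $\pi_f,\pi_h:X\times X\to Ab^{fh}$ is an abelian 2-cocycle pair. 2. If $H$ is an abelian group and $f,h:X\times X\to H$ is an abelian 2-cocycle pair, then there exists a unique group homomorphism $\rho:Ab^{fh}\to H$ such that $f=\rho\circ\pi_f$ and $h=\rho\circ\pi_h$.
   Context: Notation: for $T:X\times X\to X\times X$ write $T(x,y)=(T^1(x,y),T^2(x,y))$. $T$ is left invertible if for any $x,z$ there is a unique $y$ with $T^1(x,y)=z$; right invertible if for any $y,w$ there is a unique $x$ with $T^2(x,y)=w$. A biquandle is a pair $(X,S)$, where $S:X\times X\to X\times X$ is a bijection, left and right invertible, satisfying $(\mathrm{Id}\times S)(S\times \mathrm{Id})(\mathrm{Id}\times S)=(S\times \mathrm{Id})(\mathrm{Id}\times S)(S\times \mathrm{Id})$, and such that there is a bijection $s:X\to X$ with $\{(x,y):S(x,y)=(x,y)\}=\{(x,s(x)):x\in X\}$. Given a biquandle $(X,S)$ and a bijective, left and right invertible $\tau:X\times X\to X\times X$, $(X,S,\tau)$ is a singular pair if $\tau\circ S=S\circ\tau$, $(S\times 1)(1\times S)(\tau\times 1)=(1\times \tau)(S\times 1)(1\times S)$ and $(1\times S)(S\times 1)(1\times \tau)=(\tau\times 1)(1\times S)(S\times 1)$. For an abelian group $H$ (written multiplicatively), maps $f,h:X\times X\to H$ form an abelian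 2-cocycle pair if for all $x,y,z\in X$: (f1') $f(x,y)\,f(S^2(x,y),z)\,f(S^1(x,y),S^1(S^2(x,y),z))=f(x,S^1(y,z))\,f(S^2(x,S^1(y,z)),S^2(y,z))\,f(y,z)$; (f2') $f(x,s(x))=1$; (c1') $h(y,z)\,f(x,\tau^1(y,z))\,f(S^2(x,\tau^1(y,z)),\tau^2(y,z))=f(x,y)\,f(S^2(x,y),z)\,h(S^1(x,y),S^1(S^2(x,y),z))$; (c2') $f(y,z)\,f(x,S^1(y,z))\,h(S^2(x,S^1(y,z)),S^2(y,z))=h(x,y)\,f(\tau^2(x,y),z)\,f(\tau^1(x,y),S^1(\tau^2(x,y),z))$; (c3') $f(x,y)\,h(S(x,y))=h(x,y)\,f(\tau(x,y))$. The group $Ab^{fh}(X,S,\tau)$ is the abelian (multiplicative) group generated by symbols $(x,y)_f$ and $(x,y)_h$ for $x,y\in X$, subject to the relations, for all $x,y,z\in X$: - $(x,y)_f\,(S^2(x,y),z)_f\,(S^1(x,y),S^1(S^2(x,y),z))_f=(x,S^1(y,z))_f\,(S^2(x,S^1(y,z)),S^2(y,z))_f\,(y,z)_f$; - $(x,s(x))_f=1$; - $(y,z)_h\,(x,\tau^1(y,z))_f\,(S^2(x,\tau^1(y,z)),\tau^2(y,z))_f=(x,y)_f\,(S^2(x,y),z)_f\,(S^1(x,y),S^1(S^2(x,y),z))_h$; - $(y,z)_f\,(x,S^1(y,z))_f\,(S^2(x,S^1(y,z)),S^2(y,z))_h=(x,y)_h\,(\tau^2(x,y),z)_f\,(\tau^1(x,y),S^1(\tau^2(x,y),z))_f$;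 - $(x,y)_f\,(S(x,y))_h=(x,y)_h\,(\tau(x,y))_f$. The maps $\pi_f,\pi_h:X\times X\to Ab^{fh}$ send $(x,y)$ to the class of $(x,y)_f$ and of $(x,y)_h$, respectively. *)

(* Defs.v *)
From HB Require Import structures.
From mathcomp Require Import all_boot all_algebra.
From mathcomp Require Import boolp.
From mathcomp Require Import freeg.

Set Implicit Arguments.
Unset Strict Implicit.
Unset Printing Implicit Defensive.

Import GRing.Theory.
Local Open Scope ring_scope.

Section SingularPairs.

Variable X : Type.
Implicit Types S T tau : X * X -> X * X.

Definition T1 T (x y : X) : X := (T (x, y)).1.
Definition T2 T (x y : X) : X := (T (x, y)).2.

Definition left_invertible T :=
  forall x z, exists! y, T1 T x y = z.

Definition right_invertible T :=
  forall y w, exists! x, T2 T x y = w.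

(* Triples are left-nested pairs ((x, y), z). *)
Definition times_id T (p : X * X * X) : X * X * X := (T p.1, p.2).
Definition id_times T (p : X * X * X) : X * X * X :=
  (p.1.1, T1 T p.1.2 p.2, T2 T p.1.2 p.2).

Definition yang_baxter S :=
  id_times S \o times_id S \o id_times S =1
  times_id S \o id_times S \o times_id S.

(* Such an [s] is unique: [s x] is the only [y] with [S (x, y) = (x, y)]. *)
Definition fixed_point_map S (s : X -> X) :=
  bijective s /\ (forall p, S p = p <-> exists x, p = (x, s x)).

Definition biquandle S :=
  [/\ bijective S, left_invertible S, right_invertible S, yang_baxter S
    & exists s, fixed_point_map S s].

Definition singular_pair S tau :=
  [/\ biquandle S,
      [/\ bijective tau, left_invertible tau & right_invertible tau],
      tau \o S =1 S \o tau,
      times_id S \o id_times S \o times_id tau =1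
      id_times tau \o times_id S \o id_times S
    & id_times S \o times_id S \o id_times tau =1
      times_id tau \o id_times S \o times_id S].

(* Abelian groups are [zmodType]s, hence written additively. *)
Definition abelian_2cocycle_pair S tau (s : X -> X)
    (H : zmodType) (f h : X * X -> H) :=
  [/\ forall x y z,
        f (x, y) + f (T2 S x y, z) + f (T1 S x y, T1 S (T2 S x y) z)
        = f (x, T1 S y z) + f (T2 S x (T1 S y z), T2 S y z) + f (y, z),
      forall x, f (x, s x) = 0,
      forall x y z,
        h (y, z) + f (x, T1 tau y z) + f (T2 S x (T1 tau y z), T2 tau y z)
        = f (x, y) + f (T2 S x y, z) + h (T1 S x y, T1 S (T2 S x y) z),
      forall x y z,
        f (y, z) + f (x, T1 S y z) + h (T2 S x (T1 S y z), T2 S y z)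
        = h (x, y) + f (T2 tau x y, z) + f (T1 tau x y, T1 S (T2 tau x y) z)
    & forall x y,
        f (x, y) + h (S (x, y)) = h (x, y) + f (tau (x, y))].

End SingularPairs.

Section SubgroupGeneratedBy.

Variables (V : zmodType) (R : V -> V -> Prop).

(* The smallest subgroup of [V] containing [u - v] whenever [R u v]. *)
Definition relation_subgroup : {pred V} := fun w =>
  `[< forall A : {pred V}, zmod_closed A ->
        (forall u v, R u v -> u - v \in A) -> w \in A >].

Lemma relation_subgroup_zmod_closed : zmod_closed relation_subgroup.
Proof.
split=> [|u v /asboolP Ru /asboolP Rv]; apply/asboolP => A clA RA.
  by case: clA.
by case: (clA) => _; apply; [apply: Ru | apply: Rv].
Qed.

HB.instance Definition _ :=
  GRing.isZmodClosed.Build V relation_subgroup relation_subgroup_zmod_closed.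

End SubgroupGeneratedBy.

Section UniversalGroup.

Variables (X : Type) (S tau : X * X -> X * X) (s : X -> X).

(* [{classic _}] equips an arbitrary type with a choice structure. *)
Definition fh_symbol : choiceType :=
  ({classic (X * X)} + {classic (X * X)})%type.

Definition free_fh : zmodType := {freeg fh_symbol / int}.

Definition gen_f (p : X * X) : free_fh := << (inl p : fh_symbol) >>.
Definition gen_h (p : X * X) : free_fh := << (inr p : fh_symbol) >>.

Inductive fh_relation : free_fh -> free_fh -> Prop :=
| fh_rel_f1 x y z : fh_relation
    (gen_f (x, y) + gen_f (T2 S x y, z)
      + gen_f (T1 S x y, T1 S (T2 S x y) z))
    (gen_f (x, T1 S y z) + gen_f (T2 S x (T1 S y z), T2 S y z)
      + gen_f (y, z))
| fh_rel_f2 x : fh_relation (gen_f (x, s x)) 0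
| fh_rel_c1 x y z : fh_relation
    (gen_h (y, z) + gen_f (x, T1 tau y z)
      + gen_f (T2 S x (T1 tau y z), T2 tau y z))
    (gen_f (x, y) + gen_f (T2 S x y, z)
      + gen_h (T1 S x y, T1 S (T2 S x y) z))
| fh_rel_c2 x y z : fh_relation
    (gen_f (y, z) + gen_f (x, T1 S y z)
      + gen_h (T2 S x (T1 S y z), T2 S y z))
    (gen_h (x, y) + gen_f (T2 tau x y, z)
      + gen_f (T1 tau x y, T1 S (T2 tau x y) z))
| fh_rel_c3 x y : fh_relation
    (gen_f (x, y) + gen_h (S (x, y)))
    (gen_h (x, y) + gen_f (tau (x, y))).

Definition Ab_fh : zmodType := Quotient.quot (relation_subgroup fh_relation).

Definition pi_f (p : X * X) : Ab_fh :=
  (\pi_(Quotient.quot (relation_subgroup fh_relation)) (gen_f p))%qT.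
Definition pi_h (p : X * X) : Ab_fh :=
  (\pi_(Quotient.quot (relation_subgroup fh_relation)) (gen_h p))%qT.

End UniversalGroup.

(* Main.v *)
Require Import Defs.
From HB Require Import structures.
From mathcomp Require Import all_boot all_algebra.
From mathcomp Require Import boolp freeg.

Import GRing.Theory.
Local Open Scope ring_scope.
Local Open Scope quotient_scope.

(** [Ab_fh] is an abelian group given by generators and relations, so the
    theorem is the universal property of a presentation.  The five defining
    families of relations are, word for word, the five equations of an abelian
    2-cocycle pair, read on generators.

    Consequently (1) holds because a relator dies in the quotient
    ([pi_relation]).  For (2), a pair [f, h] extends to an additive map
    [lift_fh f h] on the free abelian group on the symbols; the cocycle
    equations say exactly that this map identifies the two sides of each
    relation ([lift_fh_relation]), so its kernel, being a subgroup, contains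
    the subgroup generated by the relators, and the map descends to the
    quotient ([quot_lift]).  The homomorphism is unique because the classes of
    the symbols generate [Ab_fh] ([Ab_fh_additive_ext]). *)

Section RelationQuotient.

Variables (V : zmodType) (R : V -> V -> Prop).
Local Notation Q := (Quotient.quot (relation_subgroup R)).

Lemma pi_relation u v : R u v -> \pi_Q u = \pi_Q v.
Proof.
move=> Ruv; apply/eqP; rewrite -Quotient.idealrBE.
by apply/asboolP => A _; apply.
Qed.

Variables (H : zmodType) (phi : {additive V -> H}).
Hypothesis phiR : forall u v, R u v -> phi u = phi v.

(** The relation subgroup is the smallest subgroup containing the relators, and
    the kernel of [phi] is a subgroup containing them. *)
Lemma relation_subgroup_ker w : w \in relation_subgroup R -> phi w = 0.
Proof.
move=> /asboolP /(_ [pred w | phi w == 0]) Rw; apply/eqP/Rw.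
  split=> [|u v]; rewrite !inE ?raddf0 // => /eqP phiu /eqP phiv.
  by rewrite raddfB phiu phiv subr0.
by move=> u v Ruv; rewrite inE raddfB (phiR _ _ Ruv) subrr.
Qed.

(** [repr] picks one element of each class; the choice is immaterial because
    [phi] is constant on classes, which is what [quot_liftE] records. *)
Definition quot_lift (a : Q) : H := phi (repr a).

Lemma quot_liftE w : quot_lift (\pi_Q w) = phi w.
Proof.
apply/eqP; rewrite -subr_eq0 -raddfB; apply/eqP/relation_subgroup_ker.
by rewrite Quotient.idealrBE reprK.
Qed.

Lemma quot_lift_is_additive : zmod_morphism quot_lift.
Proof.
move=> a b; rewrite -[a]reprK -[b]reprK -raddfB.
by rewrite !quot_liftE raddfB.
Qed.

End RelationQuotient.

(** Additive maps are structures that carry a proof besides the function, so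
    proof irrelevance is needed to pass from pointwise to Leibniz equality. *)
Lemma additive_eq (U V : zmodType) (phi psi : {additive U -> V}) :
  phi =1 psi -> phi = psi.
Proof.
case: phi psi => [phi [[phiM]]] [psi [[psiM]]] /= /funext eq_phi.
by case: _ / eq_phi psiM => psiM; rewrite (Prop_irrelevance phiM psiM).
Qed.

Lemma freeg_additive_ext (K : choiceType) (V : zmodType)
    (phi psi : {additive {freeg K / int} -> V}) :
  (forall k, phi << k >> = psi << k >>) -> phi =1 psi.
Proof.
move=> eq_gen D; rewrite -(freeg_sumE D) !raddf_sum.
apply: eq_bigr => k _; rewrite -[coeff k D]intz -freegU_mulz !raddfMz.
by rewrite eq_gen.
Qed.

Section UniversalGroup.

Variables (X : Type) (S tau : X * X -> X * X) (s : X -> X).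

(** Precomposing with the projection from the free group reduces the claim to
    the symbols, since the projection is onto. *)
Lemma Ab_fh_additive_ext (H : zmodType)
    (rho sigma : {additive Ab_fh S tau s -> H}) :
  (forall p, rho (pi_f S tau s p) = sigma (pi_f S tau s p)) ->
  (forall p, rho (pi_h S tau s p) = sigma (pi_h S tau s p)) ->
  rho =1 sigma.
Proof.
move=> eq_f eq_h a; rewrite -[a]reprK.
pose q : {additive free_fh X -> Ab_fh S tau s} := \pi_(Ab_fh S tau s).
apply: (@freeg_additive_ext _ _ (rho \o q) (sigma \o q)).
by case=> p; [apply: eq_f | apply: eq_h].
Qed.

Lemma pi_fh_cocycle_pair :
  abelian_2cocycle_pair S tau s (pi_f S tau s) (pi_h S tau s).
Proof.
pose q : {additive free_fh X -> Ab_fh S tau s} := \pi_(Ab_fh S tau s).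
have qR u v : fh_relation S tau s u v -> q u = q v by exact: pi_relation.
split=> [x y z|x|x y z|x y z|x y].
- by have := qR _ _ (fh_rel_f1 S tau s x y z); rewrite !raddfD.
- by have := qR _ _ (fh_rel_f2 S tau s x); rewrite raddf0.
- by have := qR _ _ (fh_rel_c1 S tau s x y z); rewrite !raddfD.
- by have := qR _ _ (fh_rel_c2 S tau s x y z); rewrite !raddfD.
- by have := qR _ _ (fh_rel_c3 S tau s x y); rewrite !raddfD.
Qed.

Variables (H : zmodType) (f h : X * X -> H).

(** [fglift] extends maps into modules over the ring of coefficients, here the
    integers; [zmodule H] is [H] with its canonical such structure. *)
Definition lift_fh : free_fh X -> H :=
  fglift (fun k : fh_symbol X =>
    match k with inl p => f p | inr p => h p end : zmodule H).

Lemma lift_fh_is_additive : zmod_morphism lift_fh.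
Proof. exact: (@lift_is_additive int (fh_symbol X) (zmodule H)). Qed.

HB.instance Definition _ :=
  GRing.isZmodMorphism.Build (free_fh X) H lift_fh lift_fh_is_additive.

Lemma lift_fh_gen_f p : lift_fh (gen_f p) = f p.
Proof. by rewrite /lift_fh liftU scale1r. Qed.

Lemma lift_fh_gen_h p : lift_fh (gen_h p) = h p.
Proof. by rewrite /lift_fh liftU scale1r. Qed.

Lemma lift_fh_relation u v :
  abelian_2cocycle_pair S tau s f h ->
  fh_relation S tau s u v -> lift_fh u = lift_fh v.
Proof.
by case=> f1 f2 c1 c2 c3; case=> *;
  rewrite ?raddfD ?raddf0 /= ?(lift_fh_gen_f, lift_fh_gen_h).
Qed.

End UniversalGroup.

Theorem theorem48 (X : Type) (S tau : X * X -> X * X) (s : X -> X)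
    (hST : singular_pair S tau) (hs : fixed_point_map S s) :
  abelian_2cocycle_pair S tau s (pi_f S tau s) (pi_h S tau s) /\
  (forall (H : zmodType) (f h : X * X -> H),
     abelian_2cocycle_pair S tau s f h ->
     exists! rho : {additive Ab_fh S tau s -> H},
       (forall p, f p = rho (pi_f S tau s p)) /\
       (forall p, h p = rho (pi_h S tau s p))).
Proof.
split=> [|H f h fh]; first exact: pi_fh_cocycle_pair.
have fhR u v := @lift_fh_relation _ S tau s H f h u v fh.
pose M := GRing.isZmodMorphism.Build (Ab_fh S tau s) H
  (quot_lift _ _ _ (lift_fh _ _ f h)) (quot_lift_is_additive _ _ _ _ fhR).
pose rho : {additive Ab_fh S tau s -> H} :=
  HB.pack (quot_lift _ _ _ (lift_fh _ _ f h)) M.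
have rho_f p : f p = rho (pi_f S tau s p).
  by rewrite -(lift_fh_gen_f X H f h p); apply/esym/quot_liftE.
have rho_h p : h p = rho (pi_h S tau s p).
  by rewrite -(lift_fh_gen_h X H f h p); apply/esym/quot_liftE.
exists rho; split=> // sigma [sigma_f sigma_h].
apply/additive_eq/Ab_fh_additive_ext => p.
  by rewrite -rho_f.
by rewrite -rho_h.
Qed.
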